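(* Let $n,r\in\mathbb N$ with $r\geq 3$ and $r$ dividing $n$. Let $D\in\mathbb N$ with $n/r\leq D\leq n-r$, and define $$f(n,r,D):=\min\left\{\binom{n/r+1}{2},\; D+e(\overline{T}(n-D-1,r-2))\right\}.$$ If $G$ is a graph on $n$ vertices with $\Delta(G)\leq D$ and $e(G)<f(n,r,D)$, then $G$ has an equitable $n/r$-colouring. Moreover, there exists a graph $G'$ on $n$ vertices with $\Delta(G')\leq D$ and $e(G')=f(n,r,D)$ which does not have an equitable $n/r$-colouring.
   Context: An equitable $k$-colouring of a graph is a proper vertex colouring with $k$ colours in which any two colour classes differ in size by at most one. $T(m,s)$ denotes the Turán graph: the complete $s$-partite graph on $m$ vertices whose vertex classes have sizes $\lfloor m/s\rfloor$ or $\lceil m/s\rceil$ (for $s=1$ this is the edgeless graph), and $\overline{T}(m,s)$ denotes its complement (a disjoint union of $s$ cliques of nearly equal sizes). $e(\cdot)$ denotes the number of edges and $\Delta(\cdot)$ the maximum degree. *)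

(* Defs.v *)
From mathcomp Require Import all_boot.
Set Implicit Arguments.
Unset Strict Implicit.
Unset Printing Implicit Defensive.

Record sgraph (V : finType) := SGraph {
  adj :> rel V;
  adj_sym : symmetric adj;
  adj_irr : irreflexive adj
}.

Section Graphs.
Variable V : finType.
Implicit Type G : sgraph V.

Definition edge_set G : {set {set V}} :=
  [set e : {set V} | [exists x, exists y, G x y && (e == [set x; y])]].

Definition num_edges G : nat := #|edge_set G|.

Definition degree G (x : V) : nat := #|[set y | G x y]|.

Definition max_degree G : nat := \max_(x : V) degree G x.

Definition proper_colouring G (k : nat) (c : {ffun V -> 'I_k}) : Prop :=
  forall x y, G x y -> c x <> c y.

Definition colour_class (k : nat) (c : {ffun V -> 'I_k}) (i : 'I_k) : {set V} :=
  [set x | c x == i].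

Definition equitable_colouring G (k : nat) (c : {ffun V -> 'I_k}) : Prop :=
  proper_colouring G c /\
  forall i j : 'I_k, #|colour_class c i| <= #|colour_class c j| + 1.

Definition has_equitable_colouring G (k : nat) : Prop :=
  exists c : {ffun V -> 'I_k}, equitable_colouring G c.

Definition compl_rel G : rel V := [rel x y | (x != y) && ~~ G x y].

Lemma compl_rel_sym G : symmetric (compl_rel G).
Proof. by move=> x y; rewrite /compl_rel /= eq_sym adj_sym. Qed.

Lemma compl_rel_irr G : irreflexive (compl_rel G).
Proof. by move=> x; rewrite /compl_rel /= eqxx. Qed.

Definition compl_graph G : sgraph V :=
  SGraph (compl_rel_sym G) (compl_rel_irr G).

End Graphs.

(* The vertex classes are the residue classes modulo s in {0, ..., m - 1};
   for s > 0 there are s of them, each with floor(m / s) or ceil(m / s)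
   elements.  The definition is meant only for s > 0. *)
Definition turan_rel (m s : nat) : rel 'I_m := [rel i j : 'I_m | i != j %[mod s]].

Lemma turan_rel_sym (m s : nat) : symmetric (@turan_rel m s).
Proof. by move=> i j; rewrite /turan_rel /= eq_sym. Qed.

Lemma turan_rel_irr (m s : nat) : irreflexive (@turan_rel m s).
Proof. by move=> i; rewrite /turan_rel /= eqxx. Qed.

Definition turan_graph (m s : nat) : sgraph 'I_m :=
  SGraph (@turan_rel_sym m s) (@turan_rel_irr m s).

Definition f (n r D : nat) : nat :=
  minn 'C(n %/ r + 1, 2)
       (D + num_edges (compl_graph (turan_graph (n - D - 1) (r - 2)))).

(* Main.v *)
(** Put [k = n / r] and [s = r - 2], and let [T m] be the number of edges of the
    complement of the Turan graph [T(m, s)].  The hypotheses say that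
    [e < C(k + 1, 2)] and, since [d + T (n - 1 - d)] is nonincreasing in
    [d <= n - r], that [e < d w + T (n - 1 - d w)] for every vertex [w].  This
    pair of conditions survives the deletion of an independent [r]-set [I] of
    maximal degree sum, so [I] can be taken as a colour class and [k] decreased.
    By Turan's theorem each vertex [w] lies in an independent [r]-set, hence [I]
    meets at least [d w] edges, and at least [2 * d w] of them when [w] has no
    neighbour in [I], because [w] could be exchanged with any vertex of [I].
    If all degrees are below [k], repeatedly taking a vertex of maximal degree
    and discarding [k] vertices including its closed neighbourhood gives an
    independent [r]-set of degree sum at least [2 * e / k].  The rest is
    arithmetic on [T].

    The bound is attained by a clique on [k + 1] vertices, and by a star with
    [D] edges next to the complement of [T(n - D - 1, s)]. *)

Require Import Defs.
From Stdlib Require Import ZArith Lia.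
From mathcomp Require Import all_boot zify.
Set Implicit Arguments.
Unset Strict Implicit.
Unset Printing Implicit Defensive.

(** * Edge counts of complements of Turán graphs *)

(** The number of edges of the complement of [T(m, s)]: vertex [i] is joined to the [i %/ s] smaller
    vertices congruent to it. *)
Definition cotur (s m : nat) : nat := \sum_(i < m) i %/ s.

Lemma coturS s m : cotur s m.+1 = cotur s m + m %/ s.
Proof. by rewrite /cotur big_ord_recr. Qed.

Lemma cotur_closed s m : 0 < s ->
  2 * cotur s m + s * (m %/ s) * (m %/ s).+1 = 2 * (m %/ s) * m.
Proof.
move=> s0; elim: m => [|m IH]; first by rewrite /cotur big_ord0 div0n !muln0.
rewrite coturS; have := divn_eq m s; have := divn_eq m.+1 s.
have := ltn_pmod m s0; have := ltn_pmod m.+1 s0.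
move: IH; set q := m %/ s; set q' := m.+1 %/ s.
set a := m %% s; set b := m.+1 %% s; move=> IH hb ha e1 e2.
have [e|e] : q' = q \/ q' = q.+1 by nia.
  by rewrite e; nia.
by rewrite e; nia.
Qed.

(** With one new vertex in each of the [s] cliques, every old vertex gains exactly one edge. *)
Lemma cotur_shift s m : 0 < s -> cotur s (m + s) = cotur s m + m.
Proof.
move=> s0; have := cotur_closed m s0; have := cotur_closed (m + s) s0.
rewrite divnDr ?dvdnn // divnn s0; move: (m %/ s) => q.
nia.
Qed.

Lemma cotur_small s m : m <= s -> cotur s m = 0.
Proof.
move=> ms; rewrite /cotur big1 // => i _; apply: divn_small.
exact: leq_trans ms.
Qed.

Lemma cotur_growth s m j : 0 < s -> s <= m -> cotur s m + j <= cotur s (m + j).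
Proof.
move=> s0 sm; elim: j => [|j IH]; first by rewrite !addn0.
rewrite !addnS coturS; have : 0 < (m + j) %/ s by rewrite divn_gt0 //; lia.
lia.
Qed.

(** Cauchy-Schwarz for the clique sizes, whose squares sum to [2 * cotur s m + m]. *)
Lemma cotur_cauchy s m : 0 < s -> m * m <= 2 * s * cotur s m + m * s.
Proof.
move=> s0; have := cotur_closed m s0; have := divn_eq m s.
have := ltn_pmod m s0; move: (m %/ s) (m %% s) (cotur s m) => p a c ha -> e.
have : s * (2 * c + s * p * p.+1) = s * (2 * p * (p * s + a)) by rewrite e.
nia.
Qed.

(** * The numerical side of deleting an independent set *)

Section QuadraticBound.
Local Open Scope Z_scope.

(** Serves [removal_step]: with [d = (s + 2) * K - P] and [cotur_cauchy] at [P - 1], it yields [s *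
    K * (K + 1) <= s * (2 * d + 2 * cotur s (P - 1))]. *)
Lemma quad_boundZ (s K P : Z) : 0 < s -> 2 <= K ->
  s < P -> s * ((s + 2) * K) <= (2 * s + 1) * P + s ->
  s * K * (K + 1) + (3 * s + 2) * P
    <= P * P + (s + 1) + 2 * s * (s + 2) * K.
Proof.
intros s0 K2 sP hP.
destruct (Z.eq_dec K 2) as [->|K3].
  pose proof (Z.square_nonneg (2 * P - 3 * s - 2)); nia.
assert (K3' : 3 <= K) by lia; clear K2 K3.
(* At [s = 1] the coefficient of [K * K] in the expansion below vanishes. Integrality turns [hP]
   into [K <= P], and the right side minus the left is [(P - K) * (P + K - 5) + 2]. *)
destruct (Z.eq_dec s 1) as [->|s1]; [assert (K <= P) by lia; nia|].
assert (s2 : 2 <= s) by lia; clear s1.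
set (y := (2 * s + 1) * P + s - s * ((s + 2) * K)).
assert (y0 : 0 <= y) by (unfold y; lia).
set (H := P * P + (s + 1) + 2 * s * (s + 2) * K - s * K * (K + 1) - (3 * s + 2) * P).
enough (0 <= H) by (unfold H in *; lia).
(* Expansion of the quadratic [H] in [P] at the least real [P] allowed by [hP]. *)
assert (e : (2 * s + 1) * (2 * s + 1) * H =
  s * (s * s * s - 1) * K * K + s * (2 * s * s * s - s * s - 6 * s - 1) * K
  + (10 * s * s * s + 16 * s * s + 7 * s + 1)
  + y * (2 * (s * (s + 2) * K - s) - (3 * s + 2) * (2 * s + 1)) + y * y).
  unfold H, y; ring.
clearbody H y; clear P sP hP.
assert (c0 : 0 <= 2 * (s * (s + 2) * K - s) - (3 * s + 2) * (2 * s + 1)).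
  assert (s * (s + 2) * 3 <= s * (s + 2) * K) by (apply Z.mul_le_mono_nonneg_l; nia).
  nia.
assert (c1 : 2 * (s * s) <= s * s * s) by nia.
assert (c2 : 0 <= K * (s * s * s - 1) + (2 * s * s * s - s * s - 6 * s - 1)).
  assert (3 * (s * s * s - 1) <= K * (s * s * s - 1)).
    apply Z.mul_le_mono_nonneg_r; nia.
  nia.
assert (c3 : 0 <= s * K * (K * (s * s * s - 1) + (2 * s * s * s - s * s - 6 * s - 1))).
  apply Z.mul_nonneg_nonneg; nia.
assert (c4 := Z.mul_nonneg_nonneg _ _ y0 c0).
assert (p0 : 0 < 2 * s + 1) by lia.
assert (c6 : 0 <= s * s) by nia.
assert (c5 : 0 <= (2 * s + 1) * (2 * s + 1) * H) by (rewrite e; lia).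
apply (proj1 (Z.mul_nonneg_cancel_l ((2 * s + 1) * (2 * s + 1)) H (Z.mul_pos_pos _ _ p0 p0))); exact c5.
Qed.

End QuadraticBound.

Lemma quad_bound s K P : 0 < s -> 2 <= K ->
  s < P -> s * ((s + 2) * K) <= (2 * s + 1) * P + s ->
  s * K * K.+1 + (3 * s + 2) * P
    <= P * P + s.+1 + 2 * s * (s + 2) * K.
Proof.
move=> s0 K2 sP hP.
have := @quad_boundZ (Z.of_nat s) (Z.of_nat K) (Z.of_nat P).
lia.
Qed.

(* Here [E], [E'] are twice the numbers of edges before and after deleting [I],
   [h] is the degree sum of [I], and for a vertex outside [I] [d] is the degree,
   [i] the number of neighbours in [I], and [M], [M'] the numbers of
   non-neighbours before and after.  With [P = M - s - 1]: if
   [P + 2 + P / s <= d] the loss [h] of edges outweighs the loss of [T];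
   otherwise [M] is so large that [K.+1 * K] is below the claimed bound. *)
Lemma removal_step s K d M i M' h E E' :
  0 < s -> 0 < K -> d + M + 1 = (s + 2) * K.+1 -> s < M ->
  i <= d -> i <= s + 2 -> M + i = M' + s + 2 ->
  d <= h -> (i = 0 -> 2 * d <= h) ->
  E' + 2 * h = E -> E < 2 * d + 2 * cotur s M -> E' < K.+1 * K ->
  E' < 2 * (d - i) + 2 * cotur s M'.
Proof.
move=> s0 K0 hn sM id is2 hM' dh dh2 hE hEd hEK.
have [K1|K2] : K = 1 \/ 2 <= K by lia.
  have [di|di] : 1 <= d - i \/ i = d by lia.
    by subst; lia.
  have -> : M' = s.+1 by lia.
  by rewrite coturS divnn s0; subst; lia.
have [P eP] : exists P, M = P.+1 + s by exists (M - s).-1; lia.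
have {hn} hd : d + P = (s + 2) * K by nia.
move: hEd; rewrite eP cotur_shift // coturS => hEd.
have {eP sM hM'} hM' : P + i = M'.+1 by lia.
(* If [P < s], then [cotur s M = P + 1]. For [K = 2], [d - i >= 3] while [E' < 6]; for [K >= 3],
   [E' < 2 * P + 2 <= 2 * (d - i)]. *)
have [Ps|sP] := ltnP P s.
  rewrite divn_small // cotur_small ?(ltnW Ps) // in hEd.
  have [K2'|K3] : K = 2 \/ 3 <= K by lia.
    by subst; nia.
  by nia.
have [A1|nA1] := leqP (P + 2 + P %/ s) d.
  have [i0|i0] : i = 0 \/ 0 < i by lia.
    have := dh2 i0; subst i.
    have e : P = M'.+1 by lia.
    move: hEd A1; rewrite e coturS => hEd A1 ?.
    have : M' %/ s <= M'.+1 %/ s by apply: leq_div2r.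
    by lia.
  (* Growth of [cotur] makes up for only [i - 1] of the [i] lost neighbours; the threshold [A1]
     leaves room for the last one. *)
  have -> : M' = P + i.-1 by lia.
  by have := cotur_growth i.-1 s0 sP; lia.
have PsP : P %/ s * s <= P by exact: leq_trunc_div.
have ltP : s < P.
  rewrite ltnNge; apply/negP => Ps; have ePs : P = s by lia.
  by move: nA1; rewrite ePs divnn s0; nia.
have hP : s * ((s + 2) * K) <= (2 * s + 1) * P + s.
  have : s * (d + P) <= s * (2 * P + 1 + P %/ s) by rewrite leq_pmul2l //; lia.
  by rewrite hd; lia.
have := quad_bound s0 K2 ltP hP.
have [p ep] : exists p, P = p.+1 by exists P.-1; lia.
have sp : s <= p by lia.
have := cotur_cauchy p s0.
have := cotur_growth i s0 sp; have <- : M' = p + i by lia.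
(* By [g] the [i] lost neighbours are made up for in full; the factor [s] brings in the Cauchy bound
   [c]. *)
move=> g c q; suff : s * (K.+1 * K) <= s * (2 * d + 2 * cotur s p).
  by rewrite leq_pmul2l //; lia.
have : s * (d + P) = s * ((s + 2) * K) by rewrite hd.
by subst P; lia.
Qed.

(** * Degrees and independent sets *)

Section Graph.
Variables (V : finType) (G : sgraph V).
Implicit Types (U W I J : {set V}) (x y v w : V).

Definition deg_in U x : nat := \sum_(y in U) G x y.
(* Twice the number of edges inside [U]. *)
Definition arcs U : nat := \sum_(x in U) deg_in U x.
Definition indep I : bool := [forall x in I, forall y in I, ~~ G x y].

Lemma indepP I : reflect {in I &, forall x y, ~~ G x y} (indep I).
Proof.
apply: (iffP forall_inP) => [h x y xI yI|h x xI].
  exact: (forall_inP (h x xI)).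
by apply/forall_inP => y yI; apply: h.
Qed.

Lemma deg_in_sub U J x : J \subset U -> deg_in U x = deg_in J x + deg_in (U :\: J) x.
Proof.
move=> JU; rewrite /deg_in (big_setID J) /=; congr (_ + _).
by rewrite (setIidPr JU).
Qed.

Lemma deg_in_card U x : deg_in U x = #|[set y in U | G x y]|.
Proof.
rewrite -sum1_card /deg_in big_mkcond /= [RHS]big_mkcond /=.
by apply: eq_bigr => y _; rewrite !inE; case: (y \in U); case: (G x y).
Qed.

Lemma deg_in_gt0 U x y : y \in U -> G x y -> 0 < deg_in U x.
Proof. by move=> yU xy; rewrite /deg_in (bigD1 y) //= xy. Qed.

Lemma arcs_mono U J : J \subset U -> arcs J <= arcs U.
Proof.
move=> JU; rewrite /arcs [leqRHS](big_setID J) /= (setIidPr JU).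
apply: leq_trans (leq_addr _ _); apply: leq_sum => x _.
by rewrite (deg_in_sub x JU) leq_addr.
Qed.

(** No edge has both ends in [I], so the degree sum of [I] counts each deleted edge once. *)
Lemma arcs_indep U I : I \subset U -> indep I ->
  arcs U = arcs (U :\: I) + 2 * \sum_(x in I) deg_in U x.
Proof.
move=> IU /indepP hI; rewrite {1}/arcs (big_setID I) /= (setIidPr IU).
have -> : \sum_(x in U :\: I) deg_in U x
   = \sum_(x in I) deg_in U x + arcs (U :\: I).
  under eq_bigr => x _ do rewrite (deg_in_sub x IU).
  rewrite big_split /=; congr (_ + _); rewrite /deg_in exchange_big /=.
  apply: eq_bigr => x xI; rewrite [RHS](big_setID I) /= (setIidPr IU).
  rewrite [X in _ = X + _]big1 => [|y yI]; last by rewrite (negbTE (hI _ _ xI yI)).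
  by apply: eq_bigr => y _; rewrite adj_sym.
lia.
Qed.

Lemma indep1 x : indep [set x].
Proof. by apply/indepP => y z /set1P-> /set1P->; rewrite adj_irr. Qed.

Lemma indepU1 x I : indep I -> {in I, forall y, ~~ G x y} -> indep (x |: I).
Proof.
move=> /indepP hI hx; apply/indepP => y z.
case/setU1P => [->|yI] /setU1P[->|zI]; rewrite ?adj_irr //.
- exact: hx.
- by rewrite adj_sym; apply: hx.
exact: hI.
Qed.

Lemma indepS I J : I \subset J -> indep J -> indep I.
Proof.
move=> /subsetP IJ /indepP hJ; apply/indepP => x y /IJ xJ /IJ yJ; exact: hJ.
Qed.

(** * Turán's theorem and a greedy independent set *)

Definition nonnbrs U x : {set V} := [set y in U | (y != x) && ~~ G x y].

Lemma card_nonnbrs U x : x \in U -> #|U| = deg_in U x + #|nonnbrs U x| + 1.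
Proof.
move=> xU; rewrite (cardsD1 x U) xU deg_in_card.
rewrite -(cardsID [set y | G x y] (U :\ x)).
have -> : (U :\ x) :&: [set y | G x y] = [set y in U | G x y].
  apply/setP => y; rewrite !inE; case: eqP => [->|] //=.
  by rewrite adj_irr andbF.
have -> : (U :\ x) :\: [set y | G x y] = nonnbrs U x.
  by apply/setP => y; rewrite !inE; case: (G x y); case: (y == x); case: (y \in U).
lia.
Qed.

Lemma arcs_nonnbrs U x : x \in U ->
  arcs (nonnbrs U x) + 2 * deg_in U x <= arcs U.
Proof.
move=> xU; rewrite (@arcs_indep U [set x]) ?sub1set ?indep1 // big_set1.
rewrite leq_add2r; apply: arcs_mono; apply/subsetP => y.
by rewrite !inE => /and3P[-> -> _].
Qed.

(* The bounds for all [q] are the tangents to the convex function [2 * cotur s],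
   a form that stays true at [s = 0], where the induction starts. *)
Lemma turan_indep s U :
  (exists J, [/\ J \subset U, indep J & #|J| = s.+1]) \/
  forall q, 2 * q * #|U| <= arcs U + s * q * q.+1.
Proof.
elim: s U => [|s IH] U.
  have [->|[x xU]] := set_0Vmem U; first by right=> q; rewrite cards0 muln0.
  by left; exists [set x]; rewrite sub1set xU indep1 cards1.
have [->|[x0 x0U]] := set_0Vmem U; first by right=> q; rewrite cards0 muln0.
case: (arg_minnP (deg_in U) x0U) => v /= vU vmin.
have {}vU : v \in U := vU.
have [[J [JU hJ cJ]]|h] := IH (nonnbrs U v).
  left; exists (v |: J); split.
  - rewrite subUset sub1set vU; apply: subset_trans JU _.
    by apply/subsetP => y; rewrite inE => /andP[].
  - by apply: indepU1 => // y /(subsetP JU); rewrite inE => /and3P[].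
  by rewrite cardsU1 cJ; case: (boolP (v \in J)) => // /(subsetP JU); rewrite !inE eqxx andbF.
right=> q; have := h q; have := card_nonnbrs vU.
have sub : nonnbrs U v \subset U by apply/subsetP => y; rewrite inE => /andP[].
have cD : #|U :\: nonnbrs U v| + #|nonnbrs U v| = #|U|.
  by rewrite -(cardsID (nonnbrs U v) U) (setIidPr sub) addnC.
(* Each vertex outside the non-neighbourhood of [v] has at least the degree of [v], which is
   minimal. *)
have : arcs (nonnbrs U v) + #|U :\: nonnbrs U v| * deg_in U v <= arcs U.
  rewrite {2}/arcs (big_setID (nonnbrs U v)) /= (setIidPr sub); apply: leq_add.
    by apply: leq_sum => x _; rewrite (deg_in_sub x sub) leq_addr.
  by rewrite -sum_nat_const; apply: leq_sum => x /setDP[xU _]; apply: vmin.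
move: cD; move: #|U :\: _| #|nonnbrs U v| #|U| (deg_in U v) => c m u d.
move: (arcs U) (arcs _) => a b e1 e2 e3 e4.
have ec : c = d.+1 by lia.
(* The right side minus the left is [(d - q) * (d - q + 1)], a product of consecutive integers. *)
have : 2 * q * d.+1 <= d.+1 * d + q * q.+1.
  have [le|lt] := leqP q d.
    have [z ->] : exists z, d = q + z by exists (d - q); lia.
    nia.
  have [z ->] : exists z, q = d + z.+1 by exists (q - d).-1; lia.
  nia.
subst c u; nia.
Qed.

(** By [cotur_closed], the tangent for [q = #|U| %/ s] touches [2 * cotur s] at [#|U|]. *)
Lemma turan_indep_ex s U : 0 < s -> arcs U < 2 * cotur s #|U| ->
  exists J, [/\ J \subset U, indep J & #|J| = s.+1].
Proof.
move=> s0 hU; have [//|h] := turan_indep s U.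
have := h (#|U| %/ s); have := cotur_closed #|U| s0; lia.
Qed.

Lemma subset_between (A B : {set V}) k : A \subset B -> #|A| <= k <= #|B| ->
  exists X : {set V}, [/\ A \subset X, X \subset B & #|X| = k].
Proof.
move=> AB /andP[Ak kB].
have : k - #|A| <= #|B :\: A| by rewrite cardsD (setIidPr AB); lia.
case/card_geqP => l [ul sl lsub].
exists (A :|: [set x in l]); split; first exact: subsetUl.
  rewrite subUset AB; apply/subsetP => x; rewrite inE => /lsub.
  by case/setDP.
rewrite cardsU (_ : A :&: _ = set0); last first.
  apply/setP => x; rewrite !inE; apply/negbTE/negP => /andP[xA /lsub].
  by rewrite inE xA.
rewrite cards0 cardsE (card_uniqP ul) sl; lia.
Qed.

(** Degrees are measured in the fixed [U] while [W] shrinks, so each chosen vertex bounds the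
    degrees of the [k] vertices discarded with it. *)
Lemma greedy_indep k j U W : 0 < k -> {in U, forall x, deg_in U x < k} ->
  W \subset U -> #|W| = j * k ->
  exists I, [/\ I \subset W, indep I, #|I| = j &
    \sum_(x in W) deg_in U x <= k * \sum_(x in I) deg_in U x].
Proof.
move=> k0 degk; elim: j W => [|j IH] W WU cW.
  exists set0; rewrite sub0set cards0 (cards0_eq cW) !big_set0; split=> //.
  by apply/indepP => x y; rewrite inE.
have [W0|[x0 x0W]] := set_0Vmem W.
  by move: cW; rewrite W0 cards0; lia.
case: (arg_maxnP (deg_in U) x0W) => v /= vW vmax.
have {}vW : v \in W := vW.
have vU := subsetP WU _ vW.
pose A := v |: [set y in W | G v y].
have AW : A \subset W.
  by apply/subsetP => y /setU1P[->//|]; rewrite inE => /andP[].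
have Ak : #|A| <= k.
  rewrite cardsU1; have := degk v vU; rewrite deg_in_card.
  have : #|[set y in W | G v y]| <= #|[set y in U | G v y]|.
    apply: subset_leq_card; apply/subsetP => y; rewrite !inE => /andP[/(subsetP WU)-> ->//].
  case: (_ \notin _) => /=; lia.
(* Padding the closed neighbourhood [A] to exactly [k] vertices leaves [j * k] of them for the
   induction. *)
have [|X [AX XW cX]] := @subset_between A W k AW.
  by rewrite Ak cW /= mulSn leq_addr.
have DW : W :\: X \subset W by apply: subsetDl.
have [||I [IW hI cI sI]] := IH (W :\: X).
- exact: subset_trans DW WU.
- by rewrite cardsD (setIidPr XW) cW cX mulSn addnC addnK.
have hv : {in I, forall y, (y != v) && ~~ G v y}.
  move=> y /(subsetP IW)/setDP[yW yX].
  have : y \notin A by apply: contra yX; exact: (subsetP AX).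
  by rewrite !inE yW negb_or.
have vI : v \notin I by apply/negP => /hv; rewrite eqxx.
exists (v |: I); split.
- by rewrite subUset sub1set vW (subset_trans IW).
- by apply: indepU1 => // y /hv/andP[].
- by rewrite cardsU1 vI cI.
rewrite big_setU1 //= mulnDr (big_setID X) /= (setIidPr XW).
apply: leq_add => //; rewrite -cX -sum_nat_const.
by apply: leq_sum => x xX; apply: vmax; apply: (subsetP XW).
Qed.

(** * The induction on the number of colours *)

(** The invariant of the induction, doubled since [arcs] counts each edge twice; [#|nonnbrs U w|] is
    [#|U| - 1 - deg_in U w] for [w] in [U]. *)
Definition sparse s k U := arcs U < k.+1 * k /\
  {in U, forall w, arcs U < 2 * deg_in U w + 2 * cotur s #|nonnbrs U w|}.

(** Passing to the non-neighbours of [w] loses at least [deg_in U w] edges, so Turán's theorem finds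
    [s + 1] independent vertices there. *)
Lemma indep_containing s U w : 0 < s -> w \in U ->
  arcs U < 2 * deg_in U w + 2 * cotur s #|nonnbrs U w| ->
  exists I, [/\ I \subset U, indep I, #|I| = s + 2 & w \in I].
Proof.
move=> s0 wU hw; have h := arcs_nonnbrs wU.
have [|J [JN hJ cJ]] := @turan_indep_ex s (nonnbrs U w) s0; first by lia.
have hv y : y \in J -> [/\ y \in U, y != w & ~~ G w y].
  by move/(subsetP JN); rewrite inE => /and3P[].
have wJ : w \notin J by apply/negP => /hv[_]; rewrite eqxx.
exists (w |: J); split.
- by rewrite subUset sub1set wU; apply/subsetP => y /hv[].
- by apply: indepU1 => // y /hv[].
- by rewrite cardsU1 wJ cJ; lia.
exact: setU11.
Qed.

Lemma sparse_remove s K U : 0 < s -> 0 < K -> #|U| = (s + 2) * K.+1 ->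
  sparse s K.+1 U ->
  exists I, [/\ I \subset U, indep I, #|I| = s + 2 & sparse s K (U :\: I)].
Proof.
move=> s0 K0 cU [hK hw].
pose P I := [&& I \subset U, indep I & #|I| == s + 2].
pose F I := \sum_(x in I) deg_in U x.
have [x0 x0U] : exists x, x \in U.
  by apply/set0Pn; rewrite -card_gt0 cU muln_gt0 addn_gt0 s0.
have ext w : w \in U -> exists2 I, P I & w \in I.
  move=> wU; have [I [IU hI cI wI]] := indep_containing s0 wU (hw w wU).
  by exists I; rewrite // /P IU hI cI eqxx.
have [I0 PI0 _] := ext x0 x0U.
case: (@arg_maxnP _ I0 P F PI0) => I /and3P[IU hI /eqP cI] Imax.
exists I; split=> //.
have hE : arcs (U :\: I) + 2 * F I = arcs U by rewrite (arcs_indep IU hI).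
have Fdeg w : w \in U -> deg_in U w <= F I.
  move=> /ext[J PJ wJ]; apply: leq_trans (Imax J PJ).
  by rewrite /F (bigD1 w) //= leq_addr.
have hE' : arcs (U :\: I) < K.+1 * K.
  have [|big] := boolP [forall x in U, deg_in U x < K.+1].
    move=> /forall_inP degk.
    have [J [JU hJ cJ sJ]] := greedy_indep (ltn0Sn K) degk (subxx U) cU.
    have : F J <= F I by apply: Imax; rewrite /P JU hJ cJ eqxx.
    move: sJ; rewrite -/(arcs U) -/(F J) => sJ FJI.
    (* If [F I > K], the bound [hK] drops by at least [2 * K.+1]; otherwise [arcs U <= K.+1 * F I]
       leaves at most [(K - 1) * K]. *)
    by have [FK|FK] := leqP K.+1 (F I); nia.
  case/forall_inPn: big => x xU; rewrite -leqNgt => dx.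
  by have := Fdeg x xU; lia.
split=> // w /setDP[wU wI].
have swap : deg_in I w = 0 -> 2 * deg_in U w <= F I.
  move=> dI; have nadj y : y \in I -> ~~ G w y.
    by move=> yI; apply/negP => /(deg_in_gt0 yI); rewrite dI.
  have low x : x \in I -> deg_in U w <= deg_in U x.
    move=> xI; have wIx : w \notin I :\ x by rewrite inE (negbTE wI) andbF.
    have : F (w |: I :\ x) <= F I.
      apply: Imax; rewrite /P subUset sub1set wU (subset_trans (subsetDl _ _)) //=.
      rewrite indepU1 ?(indepS (subsetDl _ _)) //=; last by move=> y /setD1P[_ /nadj].
      by rewrite cardsU1 wIx; have := cardsD1 x I; rewrite xI cI => <-.
    by rewrite /F big_setU1 //= [leqRHS](big_setD1 x) //= leq_add2r.
  have : \sum_(x in I) deg_in U w <= F I by apply: leq_sum.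
  by rewrite sum_nat_const cI; nia.
have wU' : w \in U :\: I by rewrite inE wI.
have cN := card_nonnbrs wU; have cN' := card_nonnbrs wU'.
have dN := deg_in_sub w IU.
have cU' : #|U :\: I| + (s + 2) = #|U| by rewrite -cI -(cardsID I U) (setIidPr IU) addnC.
have dIs : deg_in I w <= s + 2.
  by rewrite -cI deg_in_card subset_leq_card //; apply/subsetP => y; rewrite inE => /andP[].
have hwU := hw w wU.
(* Otherwise [cotur] vanishes and [arcs U < 2 * deg_in U w], which is absurd. *)
have sN : s < #|nonnbrs U w|.
  rewrite ltnNge; apply/negP => le; move: hwU; rewrite (cotur_small le).
  by have := arcs_nonnbrs wU; lia.
have := @removal_step s K (deg_in U w) #|nonnbrs U w| (deg_in I w)
  #|nonnbrs (U :\: I) w| (F I) (arcs U) (arcs (U :\: I)) s0 K0.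
have -> : deg_in U w - deg_in I w = deg_in (U :\: I) w by lia.
by apply=> //; try lia; exact: Fdeg.
Qed.

Lemma sparse_colouring s k U : 0 < s -> 0 < k -> #|U| = (s + 2) * k ->
  sparse s k U ->
  exists c : V -> nat, [/\ {in U, forall x, c x < k},
    {in U &, forall x y, G x y -> c x <> c y} &
    forall j, j < k -> #|[set x in U | c x == j]| = s + 2].
Proof.
move=> s0; case: k => // K _; elim: K U => [|K IH] U cU spU.
  (* With one colour, [arcs U < 2] rules out every edge. *)
  exists (fun _ => 0); split=> //.
    move=> x y xU yU xy; have := arcs_nonnbrs xU; have := deg_in_gt0 yU xy.
    by case: spU; lia.
  case=> // _; rewrite -[RHS]muln1 -cU; apply: eq_card => x.
  by rewrite !inE andbT.
have [I [IU hI cI spI]] := sparse_remove s0 (ltn0Sn K) cU spU.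
have cU' : #|U :\: I| = (s + 2) * K.+1.
  have : #|U :\: I| + (s + 2) = #|U|.
    by rewrite -cI -(cardsID I U) (setIidPr IU) addnC.
  by rewrite cU; nia.
have [c [c1 c2 c3]] := IH _ cU' spI; have /indepP nadj := hI.
exists (fun x => if x \in I then K.+1 else c x); split.
- move=> x xU; case: ifP => // xI; apply: ltnW; rewrite ltnS; apply: c1.
  by rewrite inE xI.
- move=> x y xU yU xy; case: ifP => xI; case: ifP => yI.
  + by have := nadj _ _ xI yI; rewrite xy.
  + by have := c1 y; rewrite inE yI yU => /(_ isT); lia.
  + by have := c1 x; rewrite inE xI xU => /(_ isT); lia.
  by apply: c2; rewrite // inE ?xI ?yI.
move=> j; rewrite ltnS leq_eqVlt => /orP[/eqP->|jK].
  rewrite -cI; apply: eq_card => x; rewrite inE.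
  case: (boolP (x \in I)) => xI; first by rewrite eqxx (subsetP IU).
  apply/negbTE/negP => /andP[xU /eqP e].
  by have := c1 x; rewrite inE xI xU e ltnn => /(_ isT).
rewrite -(c3 j jK); apply: eq_card => x; rewrite !inE.
by case: (x \in I) => //=; rewrite gtn_eqF ?andbF.
Qed.

(** * Counting edges *)

Lemma degree_deg_in x : degree G x = deg_in setT x.
Proof. by rewrite deg_in_card; apply: eq_card => y; rewrite !inE. Qed.

(** Ordered adjacent pairs are grouped by their set of ends; each group has two members. *)
Lemma handshake : arcs setT = 2 * num_edges G.
Proof.
pose A := [set p : V * V | G p.1 p.2].
pose ends (p : V * V) := [set p.1; p.2].
have -> : arcs setT = \sum_(p in A) 1.
  rewrite /arcs /deg_in pair_big /= [RHS]big_mkcond /=.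
  by apply: eq_big => [[x y]|[x y] _]; rewrite !inE //=; case: (G x y).
have endsE p : p \in A -> ends p \in edge_set G.
  rewrite !inE => h; apply/existsP; exists p.1; apply/existsP; exists p.2.
  by rewrite h /=.
rewrite (partition_big ends (mem (edge_set G))) //= mulnC -sum_nat_const.
apply: eq_bigr => e; rewrite inE => /existsP[x /existsP[y /andP[xy /eqP->]]].
have nxy : x != y by apply: contraTneq xy => ->; rewrite adj_irr.
rewrite sum1_card (_ : #|_| = #|[set (x, y); (y, x)]|); last first.
  apply: eq_card => -[a b]; rewrite unfold_in !inE /= /ends /= !xpair_eqE.
  apply/idP/idP => [/andP[ab /eqP eab]|].
    have : a \in [set x; y] by rewrite -eab set21.
    have : b \in [set x; y] by rewrite -eab set22.
    rewrite !inE => /orP[]/eqP eb /orP[]/eqP ea; move: ab; rewrite ea eb ?adj_irr // !eqxx ?orbT //.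
  case/orP => /andP[/eqP-> /eqP->]; first by rewrite xy eqxx.
  by rewrite adj_sym xy setUC eqxx.
by rewrite cards2 xpair_eqE (negbTE nxy).
Qed.

Lemma clique_edges (S : {set V}) :
  {in S &, forall x y, x != y -> G x y} -> #|S| * #|S|.-1 <= 2 * num_edges G.
Proof.
move=> hS; rewrite -handshake; apply: leq_trans (arcs_mono (subsetT S)).
rewrite /arcs -sum_nat_const; apply: leq_sum => x xS.
rewrite (cardsD1 x) xS /= deg_in_card; apply: subset_leq_card.
apply/subsetP => y /setD1P[yx yS]; rewrite inE yS; apply: hS => //.
by rewrite eq_sym.
Qed.

End Graph.

Lemma num_edges_ord n (G : sgraph 'I_n) :
  num_edges G = \sum_(i < n) \sum_(j < n | j < i) G i j.
Proof.
apply/eqP; rewrite -(eqn_pmul2l (ltn0Sn 1)) -handshake; apply/eqP.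
rewrite mul2n -addnn [X in _ = _ + X](exchange_big_dep xpredT) //= -big_split /= /arcs.
apply: eq_big => [i|i _]; first by rewrite inE.
rewrite /deg_in (bigID (fun j : 'I_n => j < i)) /=; congr (_ + _).
  by apply: eq_bigl => j; rewrite inE.
rewrite big_mkcond [RHS]big_mkcond /=; apply: eq_bigr => j _.
by rewrite inE /= -leqNgt adj_sym; case: ltngtP => // /val_inj->; rewrite adj_irr.
Qed.

(** Reversing the index turns congruence to [i] into divisibility of [i - j] by [s], and [i %/ s]
    counts the multiples of [s] from [1] to [i]. *)
Lemma count_congr s i : \sum_(j < i) (i == j %[mod s]) = i %/ s.
Proof.
rewrite divn_count_dvd big_add1 /= big_mkord (reindex_inj rev_ord_inj) /=.
apply: eq_bigr => j _; rewrite eqn_mod_dvd ?leq_subr // subKn //.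
Qed.

Lemma num_edges_cotur m s :
  num_edges (compl_graph (turan_graph m s)) = cotur s m.
Proof.
rewrite num_edges_ord /cotur; apply: eq_bigr => i _.
rewrite -[RHS]count_congr (big_ord_widen m (fun j => nat_of_bool (i == j %[mod s])) (ltnW (ltn_ord i))).
apply: eq_bigr => j ji; rewrite /= /compl_rel /= /turan_rel /= negbK.
by rewrite -val_eqE /= gtn_eqF.
Qed.

(* Only the values [q i j] with [j < i] matter. *)
Section OrdGraph.
Variables (n : nat) (q : rel nat).

Definition ord_rel : rel 'I_n :=
  [rel i j : 'I_n | (j < i) && q i j || (i < j) && q j i].

Lemma ord_rel_sym : symmetric ord_rel.
Proof. by move=> i j; rewrite /ord_rel /= orbC. Qed.

Lemma ord_rel_irr : irreflexive ord_rel.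
Proof. by move=> i; rewrite /ord_rel /= ltnn. Qed.

Definition ord_graph : sgraph 'I_n := SGraph ord_rel_sym ord_rel_irr.

Lemma num_edges_ord_graph :
  num_edges ord_graph = \sum_(0 <= i < n) \sum_(j < i) q i j.
Proof.
rewrite num_edges_ord big_mkord; apply: eq_bigr => i _.
rewrite (big_ord_widen n (fun j => nat_of_bool (q i j)) (ltnW (ltn_ord i))).
by apply: eq_bigr => j ji; rewrite /= /ord_rel /= ji ltnNge (ltnW ji) orbF.
Qed.

End OrdGraph.

Lemma card_ord_lt n k : k <= n -> #|[set y : 'I_n | y < k]| = k.
Proof.
move=> kn; rewrite -sum1_card -[RHS]card_ord -sum1_card.
by rewrite (big_ord_widen n (fun=> 1) kn); apply: eq_bigl => y; rewrite inE.
Qed.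

(** * The two extremal graphs *)

Lemma clique_example n k : k < n ->
  exists G : sgraph 'I_n, [/\ max_degree G <= k, num_edges G = 'C(k.+1, 2) &
    ~ has_equitable_colouring G k].
Proof.
move=> kn; pose G := ord_graph n (fun i _ => i <= k); exists G.
have Gle (x y : 'I_n) : G x y -> y <= k.
  by case/orP => /andP[lt le] //; apply: leq_trans le; apply: ltnW.
have cardk : #|[set y : 'I_n | y <= k]| = k.+1.
  by rewrite -[RHS](card_ord_lt kn); apply: eq_card => y; rewrite !inE.
split.
- apply/bigmax_leqP => x _; rewrite /degree.
  have [xk|xk] := leqP x k; last first.
    rewrite (_ : [set y | _] = set0) ?cards0 //; apply/setP => y; rewrite !inE.
    by apply/negbTE/negP; rewrite adj_sym => /Gle; lia.
  rewrite -ltnS -cardk [ltnRHS](cardsD1 x) inE xk ltnS; apply: subset_leq_card.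
  apply/subsetP => y; rewrite !inE => xy; rewrite (Gle _ _ xy) andbT.
  by apply: contraTneq xy => ->; rewrite adj_irr.
- rewrite num_edges_ord_graph (big_cat_nat (n := k.+1)) //= [X in _ + X]big_nat_cond.
  rewrite [X in _ + X]big1 ?addn0 => [|i]; last first.
    by case/andP=> /andP[ki _] _; apply: big1 => j _; rewrite leqNgt ki.
  rewrite -bin2_sum; apply: eq_big_nat => i /andP[_ ik].
  by rewrite -ltnS ik sum_nat_const card_ord muln1.
case=> c [cproper _].
pose g (i : 'I_k.+1) := c (widen_ord kn i).
have ginj : injective g.
  move=> i j gij; apply/eqP/negPn/negP => nij.
  apply: (cproper _ _ _ gij); rewrite /= /ord_rel /=.
  by move: nij; rewrite -val_eqE /=; have := ltn_ord i; have := ltn_ord j; lia.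
by have := leq_card _ ginj; rewrite !card_ord ltnn.
Qed.

(** A class smaller than [r] would force all others to at most [r], giving fewer than [r * k]
    vertices. *)
Lemma equitable_class_size (V : finType) (G : sgraph V) k r
    (c : {ffun V -> 'I_k}) i :
  #|V| = r * k -> equitable_colouring G c -> r <= #|colour_class c i|.
Proof.
move=> cV [_ hc]; rewrite leqNgt; apply/negP => lt.
have : #|V| = \sum_(j < k) #|colour_class c j|.
  rewrite -sum1_card (partition_big c xpredT) //=; apply: eq_bigr => j _.
  by rewrite -sum1_card; apply: eq_bigl => x; rewrite inE.
have : \sum_(j < k) #|colour_class c j| < \sum_(j < k) r.
  rewrite (bigD1 i) //= [ltnRHS](bigD1 i) //= -addSn; apply: leq_add => //.
  by apply: leq_sum => j _; have := hc j i; lia.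
by rewrite sum_nat_const card_ord cV mulnC; lia.
Qed.

(** Vertices below [m] form the [s] cliques, [m + D] is the centre of the star and the rest are its
    leaves. The colour class of the centre needs [s + 1] further vertices, all from the cliques, but
    each clique supplies at most one. *)
Lemma star_example s k D m : 0 < s -> 0 < k -> k <= D ->
  m + D + 1 = (s + 2) * k -> D + cotur s m <= 'C(k.+1, 2) ->
  exists G : sgraph 'I_(m + D + 1), [/\ max_degree G <= D,
    num_edges G = D + cotur s m & ~ has_equitable_colouring G k].
Proof.
move=> s0 k0 kD hn le.
pose q i j := (i < m) && (i == j %[mod s]) || (i == m + D) && (m <= j).
pose G := ord_graph (m + D + 1) q; exists G.
have eG : num_edges G = D + cotur s m.
  rewrite num_edges_ord_graph (big_cat_nat (n := m)) //=; last by lia.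
  rewrite (big_cat_nat (m := m) (n := m + D)) //=; try lia.
  rewrite addn1 big_nat1 addnA addnC; congr (_ + _).
    transitivity (\sum_(0 <= j < m + D) (m <= j)).
      rewrite big_mkord; apply: eq_bigr => j _.
      by rewrite /q eqxx ltnNge leq_addr.
    rewrite (big_cat_nat (n := m)) //=; last by lia.
    rewrite big_nat big1 ?add0n => [|j /andP[_ jm]]; last by rewrite leqNgt jm.
    rewrite big_nat (eq_bigr (fun=> 1)) => [|j /andP[-> _]] //.
    by rewrite -big_nat sum_nat_const_nat; lia.
  rewrite [X in _ + X]big_nat [X in _ + X]big1 ?addn0 => [|i /andP[mi iD]].
    rewrite big_mkord; apply: eq_bigr => i _; rewrite -[RHS]count_congr.
    apply: eq_bigr => j _; rewrite /q ltn_ord [val i == _]ltn_eqF ?orbF //.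
    exact: leq_trans (ltn_ord i) (leq_addr _ _).
  by apply: big1 => j _; rewrite /q ltnNge mi (ltn_eqF iD).
split=> //.
- apply/bigmax_leqP => x _; rewrite /degree.
  have [xm|mx] := ltnP x m.
    pose S := [set y : 'I_(m + D + 1) | (y < m) && (x == y %[mod s])].
    have xS : x \in S by rewrite inE xm eqxx.
    have hS : {in S &, forall y z, y != z -> G y z}.
      move=> y z; rewrite !inE => /andP[ym /eqP ey] /andP[zm /eqP ez].
      rewrite -val_eqE /= /ord_rel /= /q ym zm -ey -ez eqxx /=; lia.
    have := clique_edges hS; rewrite eG => le2.
    (* A clique on [D + 2] vertices would have more than ['C(k.+1, 2)] edges because [k <= D],
       against [le]. *)
    have SD : #|S| <= D.+1.
      rewrite leqNgt; apply/negP => lt; move: le; rewrite leqNgt bin2 => /negP[].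
      rewrite ltn_half_double /=; nia.
    apply: leq_trans (_ : #|S :\ x| <= D); last by move: SD; rewrite (cardsD1 x) xS.
    apply: subset_leq_card; apply/subsetP => y; rewrite !inE -val_eqE /=.
    case/orP=> /andP[lt /orP[]/andP[h1 h2]].
    - by rewrite ltn_eqF // (ltn_trans lt xm) h2.
    - by move/eqP: h1; lia.
    - by rewrite gtn_eqF // h1 eq_sym h2.
    by move: xm h2; lia.
  have [xv|xv] := eqVneq (val x) (m + D).
    have : #|[set y : 'I_(m + D + 1) | y < m]| = m by apply: card_ord_lt; lia.
    have := cardsC [set y : 'I_(m + D + 1) | y < m]; rewrite card_ord => e1 e2.
    have {e1 e2} : #|~: [set y : 'I_(m + D + 1) | y < m]| <= D.+1 by lia.
    rewrite (cardsD1 x (~: _)) !inE ltnNge mx ltnS; apply: leq_trans.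
    apply: subset_leq_card; apply/subsetP => y; rewrite !inE -val_eqE /= -leqNgt.
    case/orP=> /andP[lt /orP[]/andP[h1 h2]].
    - by rewrite ltnNge mx in h1.
    - by rewrite ltn_eqF.
    - by have := ltn_trans lt h1; rewrite ltnNge mx.
    by move/eqP: h1; lia.
  apply: leq_trans (_ : 1 <= D); last exact: leq_trans k0 kD.
  have vlt : m + D < m + D + 1 by lia.
  apply: leq_trans (_ : #|[set Ordinal vlt]| <= 1); last by rewrite cards1.
  apply: subset_leq_card; apply/subsetP => y.
  rewrite !inE -val_eqE /=.
  case/orP=> /andP[lt /orP[]/andP[h1 h2]] //.
  - by rewrite ltnNge mx in h1.
  - by rewrite (negbTE xv) in h1.
  by have := ltn_trans lt h1; rewrite ltnNge mx.
case=> c ec; have [cproper _] := ec.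
have vlt : m + D < m + D + 1 by lia.
pose v := Ordinal vlt.
have := @equitable_class_size _ _ _ (s + 2) c (c v) _ ec.
rewrite card_ord => /(_ hn); rewrite (cardsD1 v) inE eqxx.
set X := _ :\ v => cX.
have XE x : x \in X -> (x < m) /\ c x = c v.
  rewrite !inE => /andP[xv /eqP xc]; split=> //.
  rewrite ltnNge; apply/negP => mx; apply: (cproper x v) => //.
  rewrite /= /ord_rel /= /q eqxx mx orbT andbT orbC.
  by move: xv; rewrite -val_eqE /=; have := ltn_ord x; lia.
pose g (x : 'I_(m + D + 1)) : 'I_s := Ordinal (ltn_pmod x s0).
have ginj : {in X &, injective g}.
  move=> x y /XE[xm xc] /XE[ym yc] /(congr1 val) /= exy.
  apply/eqP/negPn/negP => nxy; apply: (cproper x y); last by rewrite xc yc.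
  rewrite /= /ord_rel /= /q xm ym exy eqxx /= !andbT.
  by move: nxy; rewrite -val_eqE /=; lia.
have := max_card (g @: X); rewrite (card_in_imset ginj) card_ord; lia.
Qed.

Theorem theorem1p5 (n r D : nat) (hr : 3 <= r) (hrn : r %| n)
    (hD1 : n %/ r <= D) (hD2 : D + r <= n) :
  (forall (V : finType) (G : sgraph V),
      #|V| = n -> max_degree G <= D -> num_edges G < f n r D ->
      has_equitable_colouring G (n %/ r)) /\
  (exists G' : sgraph 'I_n,
      [/\ max_degree G' <= D, num_edges G' = f n r D &
          ~ has_equitable_colouring G' (n %/ r)]).
Proof.
have [s s0 er] : exists2 s, 0 < s & r = s + 2 by exists (r - 2); lia.
have hn : n = (s + 2) * (n %/ r) by rewrite -er mulnC divnK.
rewrite /f num_edges_cotur; have -> : r - 2 = s by lia.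
rewrite addn1; move: (n %/ r) hn hD1 => k hn hD1.
have k0 : 0 < k by lia.
have [m em] : exists m, n = m + D + 1 by exists (n - D - 1); lia.
have -> : n - D - 1 = m by lia.
split=> [V G cV degD|].
  rewrite leq_min bin2 => /andP[e1 e2].
  have hs := handshake G.
  have spG : sparse G s k [set: V].
    split=> [|w _]; first by rewrite hs; move: e1; nia.
    have wdeg : deg_in G [set: V] w <= D.
      by rewrite -degree_deg_in; apply: leq_trans degD; apply: leq_bigmax.
    have := card_nonnbrs G (in_setT w); rewrite cardsT cV em => cN.
    have -> : #|nonnbrs G [set: V] w| = m + (D - deg_in G [set: V] w) by lia.
    (* Lowering the degree from [D] adds as many non-neighbours, and each adds at least one edge to
       [cotur] since [D + r <= n] gives [s <= m]. *)
    have := @cotur_growth s m (D - deg_in G [set: V] w) s0; rewrite hs; lia.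
  have [|c [c1 c2 c3]] := sparse_colouring s0 k0 _ spG; first by rewrite cardsT cV.
  pose c' := [ffun x => Ordinal (c1 x (in_setT x))]; exists c'; split.
    move=> x y xy; rewrite !ffunE => /(congr1 val) /=.
    by apply: c2; rewrite ?inE.
  have size i : #|colour_class c' i| = s + 2.
    rewrite -(c3 i (ltn_ord i)); apply: eq_card => x.
    by rewrite !inE ffunE -val_eqE.
  by move=> i j; rewrite !size leq_addr.
have [le|lt] := leqP 'C(k.+1, 2) (D + cotur s m).
  have kn : k < n by lia.
  have [G [h1 h2 h3]] := clique_example kn.
  by exists G; rewrite (leq_trans h1).
rewrite em in hn *.
exact: star_example (ltnW lt).
Qed.
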